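(* The following are four parametric solutions, in terms of arbitrary integer parameters $s$ and $t$, of the problem of finding three integers $a, b, c$ such that $a+b+c$, $ab+bc+ca$ and $abc$ are all perfect squares; in each of them one of the three integers $a,b,c$ is a square. The first two are given by polynomials of degree 8 and the remaining two by polynomials of degree 20. (1) $a = t^2(s^2-t^2)^2(s^2+t^2)$, $b = s^2(s^2-t^2)^2(s^2+t^2)$, $c = 4s^4t^4$; (2) $a = 4s^4t^2(s^2+t^2)$, $b = 4s^2t^4(s^2+t^2)$, $c = (s^4-t^4)^2$; (3) $a = 4s^4t^2(s^2+t^2)(s^6 - s^4t^2 - 5s^2t^4 + t^6)^2$, $b = (s^4-t^4)^2(s^6 - s^4t^2 - 5s^2t^4 + t^6)^2$, $c = 4s^2t^4(s^2+t^2)(3s^6 + s^4t^2 + s^2t^4 - t^6)^2$; (4) $a = t^2(s^2-t^2)^2(s^2+t^2)(3s^6 + s^4t^2 + s^2t^4 - t^6)^2$, $b = 4s^4t^4(3s^6 + s^4t^2 + s^2t^4 - t^6)^2$, $c = s^2(s^2-t^2)^2(s^2+t^2)(s^6 - s^4t^2 - 5s^2t^4 + t^6)^2$.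
   Context: A perfect square (or square) is the square of an integer. Solution (2) is the same as a solution found by Fauquembergue in 1899. *)

(* Defs.v *)
From mathcomp Require Import all_boot all_order all_algebra.
From mathcomp Require Import mpoly.

Set Implicit Arguments.
Unset Strict Implicit.
Unset Printing Implicit Defensive.

Import GRing.Theory.
Local Open Scope ring_scope.

Definition perfect_square (n : int) : Prop := exists m : int, n = m ^+ 2.

Definition is_solution (abc : int * int * int) : Prop :=
  let: (a, b, c) := abc in
  [/\ perfect_square (a + b + c),
      perfect_square (a * b + b * c + c * a)
    & perfect_square (a * b * c)].

Definition parametric_solution (f : int -> int -> int * int * int) : Prop :=
  forall s t : int, is_solution (f s t).

(* The component that is a square is the same one for all values of the
   parameters. *)
Definition one_is_square (f : int -> int -> int * int * int) : Prop :=
  [\/ forall s t : int, perfect_square (f s t).1.1,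
      forall s t : int, perfect_square (f s t).1.2
    | forall s t : int, perfect_square (f s t).2].

(* Each family is written over an arbitrary commutative ring, so that the same
   formulas give integers when s and t are integers, and polynomials in two
   variables when s and t are the indeterminates 'X_0 and 'X_1. *)

Definition sol1 (R : comNzRingType) (s t : R) : R * R * R :=
  (t ^+ 2 * (s ^+ 2 - t ^+ 2) ^+ 2 * (s ^+ 2 + t ^+ 2),
   s ^+ 2 * (s ^+ 2 - t ^+ 2) ^+ 2 * (s ^+ 2 + t ^+ 2),
   4 * s ^+ 4 * t ^+ 4).

Definition sol2 (R : comNzRingType) (s t : R) : R * R * R :=
  (4 * s ^+ 4 * t ^+ 2 * (s ^+ 2 + t ^+ 2),
   4 * s ^+ 2 * t ^+ 4 * (s ^+ 2 + t ^+ 2),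
   (s ^+ 4 - t ^+ 4) ^+ 2).

Definition sol3 (R : comNzRingType) (s t : R) : R * R * R :=
  (4 * s ^+ 4 * t ^+ 2 * (s ^+ 2 + t ^+ 2)
     * (s ^+ 6 - s ^+ 4 * t ^+ 2 - 5 * s ^+ 2 * t ^+ 4 + t ^+ 6) ^+ 2,
   (s ^+ 4 - t ^+ 4) ^+ 2
     * (s ^+ 6 - s ^+ 4 * t ^+ 2 - 5 * s ^+ 2 * t ^+ 4 + t ^+ 6) ^+ 2,
   4 * s ^+ 2 * t ^+ 4 * (s ^+ 2 + t ^+ 2)
     * (3 * s ^+ 6 + s ^+ 4 * t ^+ 2 + s ^+ 2 * t ^+ 4 - t ^+ 6) ^+ 2).

Definition sol4 (R : comNzRingType) (s t : R) : R * R * R :=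
  (t ^+ 2 * (s ^+ 2 - t ^+ 2) ^+ 2 * (s ^+ 2 + t ^+ 2)
     * (3 * s ^+ 6 + s ^+ 4 * t ^+ 2 + s ^+ 2 * t ^+ 4 - t ^+ 6) ^+ 2,
   4 * s ^+ 4 * t ^+ 4
     * (3 * s ^+ 6 + s ^+ 4 * t ^+ 2 + s ^+ 2 * t ^+ 4 - t ^+ 6) ^+ 2,
   s ^+ 2 * (s ^+ 2 - t ^+ 2) ^+ 2 * (s ^+ 2 + t ^+ 2)
     * (s ^+ 6 - s ^+ 4 * t ^+ 2 - 5 * s ^+ 2 * t ^+ 4 + t ^+ 6) ^+ 2).

Definition var_s : {mpoly int[2]} := 'X_(@Ordinal 2 0 isT).
Definition var_t : {mpoly int[2]} := 'X_(@Ordinal 2 1 isT).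

(* For a nonzero p, msize p is the total degree plus one; msize 0 = 0. *)
Definition of_degree (d : nat)
    (P : {mpoly int[2]} * {mpoly int[2]} * {mpoly int[2]}) : Prop :=
  [/\ msize P.1.1 = d.+1, msize P.1.2 = d.+1 & msize P.2 = d.+1].

(* Main.v *)
Require Import Defs.
From mathcomp Require Import all_boot all_order all_algebra.
From mathcomp Require Import mpoly.
From mathcomp Require Import ring.

Import GRing.Theory.
Local Open Scope ring_scope.

(** All the square roots are explicit polynomials, found by factoring. The roots
    for (3) and (4) share their large factors: the degree 10 root of a + b + c in
    (4) divides the root of ab + bc + ca in (3), and conversely the degree 8
    factor of the root of a + b + c in (3) divides the root of ab + bc + ca in (4).
    For the degrees, each component is homogeneous by construction, and it is
    nonzero because its value at (s, t) = (2, 1) is. *)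

Lemma sol1_parametric : parametric_solution (fun s t => sol1 s t).
Proof.
move=> s t; split.
(* Both sums rest on [(u - v) ^+ 2 + 4 * u * v = (u + v) ^+ 2]: with [u = s ^+ 4], [v = t ^+ 4] for
   [a + b + c], and with [u = s ^+ 2], [v = t ^+ 2] for the cofactor left in
   [a * b + c * (a + b)]. *)
- by exists (s ^+ 4 + t ^+ 4); ring.
- by exists (s * t * (s ^+ 2 - t ^+ 2) * (s ^+ 2 + t ^+ 2) ^+ 2); ring.
- exists (2 * s ^+ 3 * t ^+ 3 * (s ^+ 2 - t ^+ 2) ^+ 2 * (s ^+ 2 + t ^+ 2)).
  by ring.
Qed.

(** The same identity serves, with the two choices of [u] and [v] exchanged. *)
Lemma sol2_parametric : parametric_solution (fun s t => sol2 s t).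
Proof.
move=> s t; split.
- by exists ((s ^+ 2 + t ^+ 2) ^+ 2); ring.
- by exists (2 * s * t * (s ^+ 2 + t ^+ 2) * (s ^+ 4 + t ^+ 4)); ring.
- by exists (4 * s ^+ 3 * t ^+ 3 * (s ^+ 2 + t ^+ 2) * (s ^+ 4 - t ^+ 4)); ring.
Qed.

(** Let P be the sextic starting with [s ^+ 6] and Q the one starting with [3 * s ^+ 6]. This is (2)
    with [a], [c] scaled by P squared, [b] by Q squared, then [b] and [c] swapped, so [a * b * c]
    stays a square. *)
Lemma sol3_parametric : parametric_solution (fun s t => sol3 s t).
Proof.
move=> s t; split.
- exists ((s ^+ 2 + t ^+ 2)
    * (s ^+ 8 + 10 * s ^+ 4 * t ^+ 4 - 4 * s ^+ 2 * t ^+ 6 + t ^+ 8)).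
  by ring.
- exists (2 * s * t * (s ^+ 2 + t ^+ 2)
    * (s ^+ 6 - s ^+ 4 * t ^+ 2 - 5 * s ^+ 2 * t ^+ 4 + t ^+ 6)
    * (s ^+ 10 + 3 * s ^+ 8 * t ^+ 2 + 8 * s ^+ 6 * t ^+ 4
       - 4 * s ^+ 4 * t ^+ 6 - s ^+ 2 * t ^+ 8 + t ^+ 10)).
  by ring.
- exists (4 * s ^+ 3 * t ^+ 3 * (s ^+ 2 + t ^+ 2) * (s ^+ 4 - t ^+ 4)
    * (s ^+ 6 - s ^+ 4 * t ^+ 2 - 5 * s ^+ 2 * t ^+ 4 + t ^+ 6) ^+ 2
    * (3 * s ^+ 6 + s ^+ 4 * t ^+ 2 + s ^+ 2 * t ^+ 4 - t ^+ 6)).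
  by ring.
Qed.

(** Here (1) is modified likewise, with P and Q exchanged. *)
Lemma sol4_parametric : parametric_solution (fun s t => sol4 s t).
Proof.
move=> s t; split.
- exists (s ^+ 10 + 3 * s ^+ 8 * t ^+ 2 + 8 * s ^+ 6 * t ^+ 4
    - 4 * s ^+ 4 * t ^+ 6 - s ^+ 2 * t ^+ 8 + t ^+ 10).
  by ring.
- exists (s * t * (s ^+ 4 - t ^+ 4)
    * (3 * s ^+ 6 + s ^+ 4 * t ^+ 2 + s ^+ 2 * t ^+ 4 - t ^+ 6)
    * (s ^+ 8 + 10 * s ^+ 4 * t ^+ 4 - 4 * s ^+ 2 * t ^+ 6 + t ^+ 8)).
  by ring.
- exists (2 * s ^+ 3 * t ^+ 3 * (s ^+ 2 - t ^+ 2) ^+ 2 * (s ^+ 2 + t ^+ 2)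
    * (s ^+ 6 - s ^+ 4 * t ^+ 2 - 5 * s ^+ 2 * t ^+ 4 + t ^+ 6)
    * (3 * s ^+ 6 + s ^+ 4 * t ^+ 2 + s ^+ 2 * t ^+ 4 - t ^+ 6) ^+ 2).
  by ring.
Qed.

(** A nonzero homogeneous polynomial has only one degree. The separate [e] lets the degree be
    inferred first and compared with [d] afterwards. *)
Lemma msize_dhomog (n d e : nat) (R : nzRingType) (v : 'I_n -> R)
    (p : {mpoly R[n]}) :
  p \is e.-homog -> e = d -> p.@[v] != 0 -> msize p = d.+1.
Proof.
move=> p_homog <- pv_neq0.
have p_neq0 : p != 0 by apply: contraNneq pv_neq0 => ->; rewrite meval0.
by rewrite (dhomog_uniq p_neq0 p_homog (dhomog_msize p_homog)) prednK // lt0n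
  msize_poly_eq0.
Qed.

Lemma dhomog_add (n d e : nat) (R : nzRingType) (p q : {mpoly R[n]}) :
  p \is d.-homog -> q \is e.-homog -> e = d -> p + q \is d.-homog.
Proof. by move=> p_homog q_homog ed; rewrite dhomogD -?ed // ed. Qed.

Lemma dhomog_opp (n d : nat) (R : nzRingType) (p : {mpoly R[n]}) :
  p \is d.-homog -> - p \is d.-homog.
Proof. by rewrite dhomogN. Qed.

Lemma dhomog_natr (n : nat) (R : nzRingType) (k : nat) :
  (k%:R : {mpoly R[n]}) \is 0.-homog.
Proof. exact/rpredMn/dhomog1. Qed.

Lemma dhomog_mpolyX (n : nat) (R : nzRingType) (i : 'I_n) :
  ('X_i : {mpoly R[n]}) \is 1.-homog.
Proof. by rewrite dhomogX; apply/eqP/mdeg1. Qed.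

(** Reads the degree off the syntax tree as an existential variable. The two degrees in a sum agree
    only after computation, hence [reflexivity]; a difference is a sum with an opposite. *)
Ltac infer_dhomog :=
  lazymatch goal with
  | |- is_true (_ ^+ _ \is _) => eapply dhomogMn; infer_dhomog
  | |- is_true (_ * _ \is _) => eapply dhomogM; infer_dhomog
  | |- is_true (_ + _ \is _) =>
      eapply dhomog_add; [infer_dhomog | infer_dhomog | reflexivity]
  | |- is_true (- _ \is _) => eapply dhomog_opp; infer_dhomog
  | |- is_true (_%:R \is _) => apply: dhomog_natr
  | |- _ => apply: dhomog_mpolyX
  end.

Ltac compute_msize :=
  rewrite /= /var_s /var_t;
  (* The point (1, 1) would kill [s ^+ 2 - t ^+ 2]; at (2, 1) the two sextics are 29 and 211. *)
  eapply (@msize_dhomog _ _ _ _ (fun i => if i == 0 :> nat then 2 else 1));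
  [infer_dhomog
  |reflexivity
  |by rewrite !(rmorph_nat, rmorphXn, rmorphM, rmorphB, rmorphD) /= !mevalXU
     !(mulf_eq0, expf_eq0)].

Lemma sol1_degree : of_degree 8 (sol1 var_s var_t).
Proof. by split; compute_msize. Qed.

Lemma sol2_degree : of_degree 8 (sol2 var_s var_t).
Proof. by split; compute_msize. Qed.

Lemma sol3_degree : of_degree 20 (sol3 var_s var_t).
Proof. by split; compute_msize. Qed.

Lemma sol4_degree : of_degree 20 (sol4 var_s var_t).
Proof. by split; compute_msize. Qed.

Theorem mainTheorem2 :
  [/\ parametric_solution (fun s t => sol1 s t),
      parametric_solution (fun s t => sol2 s t),
      parametric_solution (fun s t => sol3 s t)
    & parametric_solution (fun s t => sol4 s t)]
  /\
  [/\ one_is_square (fun s t => sol1 s t),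
      one_is_square (fun s t => sol2 s t),
      one_is_square (fun s t => sol3 s t)
    & one_is_square (fun s t => sol4 s t)]
  /\
  [/\ of_degree 8 (sol1 var_s var_t),
      of_degree 8 (sol2 var_s var_t),
      of_degree 20 (sol3 var_s var_t)
    & of_degree 20 (sol4 var_s var_t)].
Proof.
split; last split.
- by split; [exact: sol1_parametric | exact: sol2_parametric
    | exact: sol3_parametric | exact: sol4_parametric].
- split.
  + by constructor 3 => s t; exists (2 * s ^+ 2 * t ^+ 2) => /=; ring.
  + by constructor 3 => s t; exists (s ^+ 4 - t ^+ 4).
  + constructor 2 => s t; exists ((s ^+ 4 - t ^+ 4)
      * (s ^+ 6 - s ^+ 4 * t ^+ 2 - 5 * s ^+ 2 * t ^+ 4 + t ^+ 6)) => /=.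
    by rewrite exprMn.
  + constructor 2 => s t; exists (2 * s ^+ 2 * t ^+ 2
      * (3 * s ^+ 6 + s ^+ 4 * t ^+ 2 + s ^+ 2 * t ^+ 4 - t ^+ 6)) => /=.
    by ring.
- by split; [exact: sol1_degree | exact: sol2_degree
    | exact: sol3_degree | exact: sol4_degree].
Qed.
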